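(* Let $G=(V_1\cup V_2,E,\mathit{Wt})$ be an undirected bipartite graph with edge weights $\mathit{Wt}:E\to\mathbb{N}=\{1,2,\dots\}$, with at least one edge. Let $H_1=N$ be the largest edge weight of $G$, and let $H_2<H_1$ be the second largest distinct edge weight of $G$, with $H_2=0$ if all edge weights are equal. Then for every integer $h$ with $1\le h\le H_1-H_2$: (a) the maximum weight matchings of $G_h$ are exactly its maximum cardinality matchings, i.e. $\mathit{mwm}(G_h)=\mathit{mm}(G_h)$; (b) $\mathit{Wt}(\mathit{mwm}(G)) = h\cdot|\mathit{mm}(G_h)| + \mathit{Wt}(\mathit{mwm}(G_h^\Delta))$, where $G_h^\Delta$ is built from an arbitrary minimum weight cover $C_h$ of $G_h$.
   Context: A matching is a set of edges no two sharing a vertex; $\mathit{mm}(H)$ denotes a maximum cardinality matching of a graph $H$, and $\mathit{mwm}(H)$ a maximum weight matching, where the weight of a matching is the sum of its edge weights; $\mathit{Wt}(\mathit{mwm}(H))$ is the maximum weight of a matching of $H$ (equal to $0$ if $H$ has no edges). For an integer $h\in[1,N]$, $G_h$ is the bipartite graph on the same vertex set whose edges are the edges $\{u,v\}$ of $G$ with $\mathit{Wt}(u,v)\in[N-h+1,N]$, each given weight $\mathit{Wt}(u,v)-(N-h)$. A cover of a weighted bipartite graph $H$ with parts $V_1,V_2$ is a function $C:V_1\cup V_2\to\mathbb{N}_0$ with $C(v_1)+C(v_2)\ge \mathit{Wt}(v_1,v_2)$ for every edge $\{v_1,v_2\}$; its weight is $\sum_x C(x)$, and a minimum weight cover is a cover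 of minimum weight. Given a minimum weight cover $C_h$ of $G_h$, $G_h^\Delta$ is the bipartite graph on the same vertex set whose edges are the edges $\{u,v\}$ of $G$ with $\mathit{Wt}(u,v)-C_h(u)-C_h(v)>0$, each given weight $\mathit{Wt}(u,v)-C_h(u)-C_h(v)$. *)

(* Defs.v *)
From HB Require Import structures.
From mathcomp Require Import all_boot.
Set Implicit Arguments.
Unset Strict Implicit.
Unset Printing Implicit Defensive.

(* The undirected edge {v1, v2} of a bipartite graph with parts V1 and V2 is
   represented by the pair (v1, v2), and V1 + V2 is the vertex set.  The values
   of wt outside edges are irrelevant. *)
Record wbigraph (V1 V2 : finType) := WBigraph {
  edges : {set V1 * V2};
  wt : V1 * V2 -> nat;
  wt_gt0 : forall e, e \in edges -> 0 < wt e }.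

Section Matchings.
Variables (V1 V2 : finType) (H : wbigraph V1 V2).
Implicit Type M : {set V1 * V2}.

Definition matching M : bool :=
  (M \subset edges H) &&
  [forall e in M, forall f in M, (e != f) ==> (e.1 != f.1) && (e.2 != f.2)].

Definition weight M : nat := \sum_(e in M) wt H e.

(* The empty set is a matching, so neither maximum is over an empty range. *)
Definition max_matching_card : nat := \max_(M : {set V1 * V2} | matching M) #|M|.
Definition max_matching_weight : nat := \max_(M : {set V1 * V2} | matching M) weight M.

Definition mm : {set {set V1 * V2}} :=
  [set M | matching M & #|M| == max_matching_card].
Definition mwm : {set {set V1 * V2}} :=
  [set M | matching M & weight M == max_matching_weight].

Definition is_cover (C : V1 + V2 -> nat) : Prop :=
  forall v1 v2, (v1, v2) \in edges H -> wt H (v1, v2) <= C (inl v1) + C (inr v2).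

Definition cover_weight (C : V1 + V2 -> nat) : nat := \sum_x C x.

Definition is_min_cover (C : V1 + V2 -> nat) : Prop :=
  is_cover C /\ forall C', is_cover C' -> cover_weight C <= cover_weight C'.

End Matchings.

Section Decomposition.
Variables (V1 V2 : finType) (G : wbigraph V1 V2).

Definition largest_wt : nat := \max_(e in edges G) wt G e.

(* Equal to 0 when all edge weights coincide, as the maximum is then empty. *)
Definition second_wt : nat :=
  \max_(e in edges G | wt G e < largest_wt) wt G e.

(* G_h, for 1 <= h <= N, N being the largest weight; no subtraction is
   truncated on this range. *)
Definition top_edges (h : nat) : {set V1 * V2} :=
  [set e in edges G | largest_wt - h + 1 <= wt G e <= largest_wt].
Definition top_wt (h : nat) (e : V1 * V2) : nat := wt G e - (largest_wt - h).

Fact top_wt_gt0 h e : e \in top_edges h -> 0 < top_wt h e.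
Proof. by rewrite inE addn1 subn_gt0 => /and3P[]. Qed.

Definition top_graph (h : nat) : wbigraph V1 V2 := WBigraph (@top_wt_gt0 h).

(* G_h^Delta for a cover C; truncated subtraction is positive exactly when the
   integer difference is, and then they agree. *)
Definition residual_wt (C : V1 + V2 -> nat) (e : V1 * V2) : nat :=
  wt G e - C (inl e.1) - C (inr e.2).
Definition residual_edges (C : V1 + V2 -> nat) : {set V1 * V2} :=
  [set e in edges G | 0 < residual_wt C e].

Fact residual_wt_gt0 C e : e \in residual_edges C -> 0 < residual_wt C e.
Proof. by rewrite inE => /andP[]. Qed.

Definition residual_graph (C : V1 + V2 -> nat) : wbigraph V1 V2 :=
  WBigraph (@residual_wt_gt0 C).

End Decomposition.

(* Main.v *)
Require Import Defs.
From HB Require Import structures.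
From mathcomp Require Import all_boot.
From mathcomp Require Import zify.
Set Implicit Arguments.
Unset Strict Implicit.
Unset Printing Implicit Defensive.

(** By Egerváry's theorem matchings can be replaced by covers.  If [D] is a
    minimum cover of [G] and [C] one of [G_h], put [k = N - h], so that a cover
    of [G_h] is one of the weights [wt - k].  Uncrossing [D] with [C] gives the
    pairs of functions on [V_1] and [V_2] [(min D (C + k), max D C)], a cover of
    [G], and [(max (D - k) C, min D C)], a cover of [G_h], whose weights add up
    to those of [D] and [C]; as [C] is minimum, the first one is no heavier than
    [D].  Doing this once for each side yields a minimum cover
    of [G] above [C], and subtracting [C] from it leaves a cover of the residual
    graph.  This decomposition holds for all [h <= N]; when [h] is at most
    [H_1 - H_2], all edges of [G_h] have weight [h]. *)

(** * Covers: weak duality and uncrossing *)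

Section Covers.
Variables I J : finType.
Implicit Types (w : I -> J -> nat) (a : I -> nat) (b : J -> nat).

Definition covers w a b := forall i j, w i j <= a i + b j.

Definition total a b := \sum_i a i + \sum_j b j.

Lemma total_leD a1 a2 a3 a4 b1 b2 b3 b4 :
  (forall i, a1 i + a2 i <= a3 i + a4 i) ->
  (forall j, b1 j + b2 j <= b3 j + b4 j) ->
  total a1 b1 + total a2 b2 <= total a3 b3 + total a4 b4.
Proof.
move=> lea leb; rewrite /total addnACA [X in _ <= X]addnACA -!big_split /=.
by rewrite leq_add // leq_sum.
Qed.

Definition disjoint_edges (M : {set I * J}) :=
  {in M &, forall e f, e != f -> (e.1 != f.1) && (e.2 != f.2)}.

(** Weak duality: the edges of [M] have distinct ends on each side, so summing [a] and [b] over
    these ends counts each vertex at most once. *)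
Lemma matching_le_cover w a b M :
  covers w a b -> disjoint_edges M -> \sum_(e in M) w e.1 e.2 <= total a b.
Proof.
move=> cov dM; apply: (@leq_trans (\sum_(e in M) (a e.1 + b e.2))).
  by apply: leq_sum => e _; apply: cov.
have inj1 : {in M &, injective fst}.
  by move=> e f eM fM ef; apply: contra_eq ef => /(dM _ _ eM fM)/andP[].
have inj2 : {in M &, injective snd}.
  by move=> e f eM fM ef; apply: contra_eq ef => /(dM _ _ eM fM)/andP[].
rewrite big_split /= -(big_imset a inj1) -(big_imset b inj2) /total.
rewrite [X in _ <= X + _](bigID [in fst @: M]) /=.
rewrite [X in _ <= _ + X](bigID [in snd @: M]) /=.
by rewrite leq_add ?leq_addr.
Qed.

(** With [k = a2 u - a1 u], the shifted cover [(a1 + k, b1 - k)] agrees with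
    [(a2, b2)] at [u].  Hence one of the two covers obtained by uncrossing
    covers both deficient edges, and in the other the deficient edges all
    contain [u], so that one more unit at [u] repairs it. *)
Lemma uncross_at w u v1 v2 a1 b1 a2 b2 :
  v1 != v2 ->
  covers (fun i j => w i j - ((i == u) && (j == v1))) a1 b1 ->
  covers (fun i j => w i j - ((i == u) && (j == v2))) a2 b2 ->
  exists a b a' b', [/\ covers w a b, covers w a' b' &
    total a b + total a' b' <= (total a1 b1 + total a2 b2).+1].
Proof.
wlog le_u : v1 v2 a1 b1 a2 b2 / a1 u <= a2 u.
  move=> IH nv c1 c2; have [le_u|/ltnW le_u] := leqP (a1 u) (a2 u); first exact: IH le_u nv c1 c2.
  by rewrite [total a1 b1 + _]addnC; apply: IH le_u _ c2 c1; rewrite eq_sym.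
move=> nv c1 c2; pose k := a2 u - a1 u.
exists (fun i => minn (a1 i + k) (a2 i)), (fun j => maxn (b1 j - k) (b2 j)).
exists (fun i => maxn (a1 i) (a2 i - k) + (i == u)), (fun j => minn (b1 j) (b2 j + k)).
split.
- move=> i j; move: (c1 i j) (c2 i j).
  have [->|_] := eqVneq i u; last by lia.
  have [->|_] := eqVneq j v1; last by rewrite /k; lia.
  by rewrite (negbTE nv) /k; lia.
- move=> i j; move: (c1 i j) (c2 i j).
  by have [->|_] := eqVneq i u; rewrite /k; lia.
- have -> : total (fun i => maxn (a1 i) (a2 i - k) + (i == u))
                  (fun j => minn (b1 j) (b2 j + k)) =
            (total (fun i => maxn (a1 i) (a2 i - k))
                   (fun j => minn (b1 j) (b2 j + k))).+1.
    by rewrite /total big_split /= -big_mkcond big_pred1_eq addnAC addn1.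
  by rewrite addnS ltnS; apply: total_leD => [i|j]; lia.
Qed.

Lemma uncross_min_cover w k ac bc ad bd :
  covers (fun i j => w i j - k) ac bc ->
  (forall a b, covers (fun i j => w i j - k) a b -> total ac bc <= total a b) ->
  covers w ad bd ->
  let ad' i := minn (ad i) (ac i + k) in
  let bd' j := maxn (bd j) (bc j) in
  covers w ad' bd' /\ total ad' bd' <= total ad bd.
Proof.
move=> covC minC covD ad' bd'.
split=> [i j|]; first by move: (covC i j) (covD i j); rewrite /ad' /bd'; lia.
have /minC le : covers (fun i j => w i j - k)
    (fun i => maxn (ad i - k) (ac i)) (fun j => minn (bd j) (bc j)).
  by move=> i j; move: (covC i j) (covD i j); lia.
rewrite -(leq_add2r (total ac bc)); apply: leq_trans (leq_add (leqnn _) le) _.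
by apply: total_leD => [i|j]; rewrite /ad' /bd'; lia.
Qed.

End Covers.

(** * Exchange of sides and Egerváry's theorem *)

Lemma totalC (I J : finType) (a : I -> nat) (b : J -> nat) :
  total a b = total b a.
Proof. exact: addnC. Qed.

Lemma coversC (I J : finType) (w : I -> J -> nat) a b :
  covers w a b -> covers (fun j i => w i j) b a.
Proof. by move=> cov j i; rewrite addnC. Qed.

(** Induction on the total weight.  If two edges [e] and [f] of positive weight
    share an end, lower one or the other by one unit: one of the two covers
    obtained by uncrossing is then optimal, with the matching found for [w - e]
    or for [w - f]. *)
Theorem egervary (I J : finType) (w : I -> J -> nat) :
  exists a b M, [/\ covers w a b, disjoint_edges M &
    total a b <= \sum_(e in M) w e.1 e.2].
Proof.
have [n] := ubnP (\sum_i \sum_j w i j); elim: n w => // n IHn w; rewrite ltnS => lew.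
have IH (e : I * J) : 0 < w e.1 e.2 -> exists a b M,
    [/\ covers (fun i j => w i j - ((i == e.1) && (j == e.2))) a b,
        disjoint_edges M & total a b <= \sum_(e in M) w e.1 e.2].
  move=> we; have [|a [b [M [cov dM le]]]] :=
      IHn (fun i j => w i j - ((i == e.1) && (j == e.2))).
    apply: leq_trans lew; rewrite !pair_bigA /=.
    rewrite (bigD1 e) //= [X in _ < X](bigD1 e) //= !eqxx -addSn leq_add //=; first by lia.
    by apply: leq_sum => f _; apply: leq_subr.
  by exists a, b, M; split=> //; apply: (leq_trans le); apply: leq_sum => f _; apply: leq_subr.
have [/existsP[e /existsP[f /and4P[we wf nef]]]|noadj] := boolP [exists e : I * J,
  exists f : I * J, [&& 0 < w e.1 e.2, 0 < w f.1 f.2, e != f &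
                        (e.1 == f.1) || (e.2 == f.2)]].
- have [a1 [b1 [M1 [cov1 dM1 le1]]]] := IH e we.
  have [a2 [b2 [M2 [cov2 dM2 le2]]]] := IH f wf.
  move=> adj; have [a [b [a' [b' [cov cov' le]]]]] :
      exists a b a' b', [/\ covers w a b, covers w a' b' &
        total a b + total a' b' <= (total a1 b1 + total a2 b2).+1].
    case/orP: adj => /eqP ef; move: nef cov1 cov2; rewrite -pair_eqE /pair_eq /= ef eqxx /=.
      by rewrite ?andbT; apply: uncross_at.
    rewrite andbT => nef /coversC cov1 /coversC cov2.
    case: (@uncross_at _ _ (fun j i => w i j) f.2 e.1 f.1 b1 a1 b2 a2 nef).
    + by move=> j i; rewrite andbC; apply: cov1.
    + by move=> j i; rewrite andbC; apply: cov2.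
    move=> b [a [b' [a' [/coversC cov /coversC cov' le]]]].
    by exists a, b, a', b'; split=> //; rewrite !(totalC a) !(totalC a') (totalC a1) (totalC a2).
  (* The extra unit is harmless: if the first cover is heavier than [(a1, b1)], it absorbs the unit,
     which leaves at most [total a2 b2] for the second. *)
  have [leM1|ltM1] := leqP (total a b) (total a1 b1).
    by exists a, b, M1; split=> //; apply: leq_trans le1.
  by exists a', b', M2; split=> //; apply: leq_trans le2; lia.
(* The positive edges are now pairwise disjoint: they form a matching whose weight is the sum of all
   entries of [w], as is the total of the row sums. *)
- exists (fun i => \sum_j w i j), (fun=> 0), [set e | 0 < w e.1 e.2]; split.
  + by move=> i j; rewrite addn0 (bigD1 j) //= leq_addr.
  + move=> e f; rewrite !inE => we wf nef; rewrite -negb_or.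
    apply: contra noadj => adj; apply/existsP; exists e; apply/existsP; exists f.
    by rewrite we wf nef.
  + rewrite /total [X in _ + X]big1 // addn0 pair_bigA /= [X in _ <= X]big_mkcond /=.
    by apply: leq_sum => e _; rewrite inE; case: posnP => // ->.
Qed.

(** * Duality for weighted bipartite graphs *)

Section WeightedGraphs.
Variables (V1 V2 : finType) (H : wbigraph V1 V2).

(** Extension by 0 makes the cover condition automatic on non-edges, where [wt] is arbitrary. *)
Definition ext_wt (u : V1) (v : V2) : nat :=
  if (u, v) \in edges H then wt H (u, v) else 0.

Definition glue (a : V1 -> nat) (b : V2 -> nat) (x : V1 + V2) : nat :=
  match x with inl u => a u | inr v => b v end.

Lemma cover_weightE (C : V1 + V2 -> nat) :
  cover_weight C = total (C \o inl) (C \o inr).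
Proof. exact: big_sumType. Qed.

Lemma is_coverE (C : V1 + V2 -> nat) :
  is_cover H C <-> covers ext_wt (C \o inl) (C \o inr).
Proof.
split=> cov u v; first by rewrite /ext_wt; case: ifP => // /cov.
by move=> uv; move: (cov u v); rewrite /ext_wt uv.
Qed.

Lemma matchingP (M : {set V1 * V2}) :
  reflect (M \subset edges H /\ disjoint_edges M) (matching H M).
Proof.
apply: (iffP andP) => [[sM dM]|[sM dM]]; split=> //.
  by move=> e f eM fM; move/forall_inP/(_ e eM)/forall_inP/(_ f fM)/implyP: dM.
by apply/forall_inP => e eM; apply/forall_inP => f fM; apply/implyP/dM.
Qed.

Lemma weight_ext_wt (M : {set V1 * V2}) :
  M \subset edges H -> weight H M = \sum_(e in M) ext_wt e.1 e.2.
Proof.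
by move=> /subsetP sM; apply: eq_bigr => -[u v] /sM uv; rewrite /ext_wt uv.
Qed.

Lemma disjoint_edges_sum_le (M : {set V1 * V2}) : disjoint_edges M ->
  \sum_(e in M) ext_wt e.1 e.2 <= max_matching_weight H.
Proof.
move=> dM; have mM : matching H (M :&: edges H).
  apply/matchingP; split; first exact: subsetIr.
  by move=> e f /setIP[eM _] /setIP[fM _]; apply: dM.
apply: leq_trans (leq_bigmax_cond (F := weight H) _ mM); rewrite weight_ext_wt ?subsetIr //.
rewrite (big_setID (edges H)) /= [X in _ + X]big1 ?addn0 // => -[u v].
by rewrite inE /ext_wt => /andP[/negbTE->].
Qed.

Lemma max_matching_weight_le_cover a b :
  covers ext_wt a b -> max_matching_weight H <= total a b.
Proof.
move=> cov; apply/bigmax_leqP => M /matchingP[sM dM].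
by rewrite weight_ext_wt //; apply: matching_le_cover.
Qed.

Lemma exists_optimal_cover :
  exists a b, covers ext_wt a b /\ total a b = max_matching_weight H.
Proof.
have [a [b [M [cov dM le]]]] := egervary ext_wt; exists a, b; split=> //.
apply/eqP; rewrite eqn_leq max_matching_weight_le_cover // andbT.
exact: leq_trans (disjoint_edges_sum_le dM).
Qed.

Lemma min_cover_weight (C : V1 + V2 -> nat) :
  is_min_cover H C -> cover_weight C = max_matching_weight H.
Proof.
move=> [/is_coverE cov minC]; apply/eqP; rewrite eqn_leq {2}cover_weightE.
rewrite max_matching_weight_le_cover // andbT.
have [a [b [covab <-]]] := exists_optimal_cover.
have /minC : is_cover H (glue a b) by apply/is_coverE.
by rewrite [cover_weight (glue _ _)]cover_weightE.
Qed.

End WeightedGraphs.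

(** * Decomposition of the maximum weight along [G_h] *)

Section Decomposition.
Variables (V1 V2 : finType) (G : wbigraph V1 V2).

Lemma wt_le_largest e : e \in edges G -> wt G e <= largest_wt G.
Proof. exact: leq_bigmax_cond. Qed.

(** Edges of [G] left out of [G_h] weigh at most [N - h], so truncation sends them to 0. *)
Lemma ext_wt_top h u v :
  ext_wt (top_graph G h) u v = ext_wt G u v - (largest_wt G - h).
Proof.
rewrite /ext_wt /= inE; case: ifP => [/andP[-> _] //|].
by case: ifP => //= uv; rewrite wt_le_largest // andbT /top_wt; lia.
Qed.

Lemma ext_wt_residual C u v :
  ext_wt (residual_graph G C) u v = ext_wt G u v - C (inl u) - C (inr v).
Proof.
rewrite /ext_wt /= inE; case: ifP => [/andP[-> _] //|].
by case: ifP => //= uv; rewrite /residual_wt /=; lia.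
Qed.

(** Adding [C] to an optimal cover of the residual graph gives a cover of [G]. *)
Lemma max_matching_weight_residual_ge C :
  max_matching_weight G <= cover_weight C + max_matching_weight (residual_graph G C).
Proof.
have [a [b [cov <-]]] := exists_optimal_cover (residual_graph G C).
apply: (@leq_trans (total (fun u => C (inl u) + a u) (fun v => C (inr v) + b v))).
  apply: max_matching_weight_le_cover => u v.
  by move: (cov u v); rewrite ext_wt_residual; lia.
by rewrite cover_weightE /total !big_split /= addnACA.
Qed.

Lemma max_matching_weight_residual_le h C : is_min_cover (top_graph G h) C ->
  cover_weight C + max_matching_weight (residual_graph G C) <= max_matching_weight G.
Proof.
set k := largest_wt G - h; move=> [/is_coverE covC minC].
pose ac := C \o inl; pose bc := C \o inr.
have covC' : covers (fun u v => ext_wt G u v - k) ac bc.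
  by move=> u v; rewrite -ext_wt_top; apply: covC.
have minC' a b : covers (fun u v => ext_wt G u v - k) a b -> total ac bc <= total a b.
  move=> cov; have /minC : is_cover (top_graph G h) (glue a b).
    by apply/is_coverE => u v; rewrite ext_wt_top; apply: cov.
  by rewrite !cover_weightE.
have [a0 [b0 [cov0 <-]]] := exists_optimal_cover G.
have [cov1 le1] := uncross_min_cover covC' minC' cov0.
(* The first uncrossing puts the cover above [C] on [V2]; this one, with sides exchanged, does so on
   [V1], and its cap [bc + k] preserves the bound on [V2]. *)
have [|/coversC cov2 le2] := uncross_min_cover (coversC covC') _ (coversC cov1).
  by move=> b a /coversC/minC'; rewrite !(totalC b) (totalC bc).
rewrite totalC [X in _ <= X]totalC in le2; apply: leq_trans le1; apply: leq_trans le2.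
move: cov2; set a2 := (X in covers _ X _); set b2 := (X in covers _ _ X) => cov2.
have lea u : C (inl u) <= a2 u by apply: leq_maxr.
have leb v : C (inr v) <= b2 v by rewrite /b2 /bc /=; lia.
rewrite cover_weightE; set r := max_matching_weight _.
have le_r : r <= total (fun u => a2 u - C (inl u)) (fun v => b2 v - C (inr v)).
  apply: max_matching_weight_le_cover => u v; rewrite ext_wt_residual.
  by move: (cov2 u v) (lea u) (leb v); lia.
apply: leq_trans (leq_add (leqnn _) le_r) _.
rewrite /total addnACA -!big_split /=.
by apply: leq_add; apply: leq_sum => x _; rewrite subnKC.
Qed.

(** An edge lighter than [N] weighs at most [second_wt G], hence at most [N - h], and so lies
    outside [G_h]. *)
Lemma top_wtE h e : h <= largest_wt G - second_wt G ->
  e \in top_edges G h -> top_wt G h e = h.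
Proof.
move=> hh; rewrite inE => /and3P[eE lo hi].
have [e_lt|] := ltnP (wt G e) (largest_wt G); last by rewrite /top_wt; lia.
suff : wt G e <= second_wt G by lia.
by apply: leq_bigmax_cond; rewrite eE.
Qed.

Lemma weight_top h M : h <= largest_wt G - second_wt G ->
  matching (top_graph G h) M -> weight (top_graph G h) M = h * #|M|.
Proof.
move=> hh /matchingP[/subsetP sM _].
rewrite mulnC -sum_nat_const; apply: eq_bigr => e /sM.
exact: top_wtE.
Qed.

Lemma max_matching_weight_top h : h <= largest_wt G - second_wt G ->
  max_matching_weight (top_graph G h) = h * max_matching_card (top_graph G h).
Proof.
move=> hh; rewrite /max_matching_card (big_endo (muln h)) ?muln0 //.
  by apply: eq_bigr => M; apply: weight_top.
exact: maxnMr.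
Qed.

End Decomposition.

Theorem theorem2 (V1 V2 : finType) (G : wbigraph V1 V2) (h : nat)
  (hE : edges G != set0)
  (hh : 1 <= h <= largest_wt G - second_wt G) :
  mwm (top_graph G h) = mm (top_graph G h) /\
  (forall C : V1 + V2 -> nat, is_min_cover (top_graph G h) C ->
     max_matching_weight G =
       h * max_matching_card (top_graph G h) + max_matching_weight (residual_graph G C)).
Proof.
case/andP: hh => h_gt0 hh; split=> [|C minC].
  apply/setP => M; rewrite !inE; apply: andb_id2l => mM.
  by rewrite weight_top // max_matching_weight_top // eqn_pmul2l.
(* By duality, the term [h * max_matching_card _] is the weight of [C]. *)
rewrite -max_matching_weight_top // -(min_cover_weight minC); apply/eqP.
by rewrite eqn_leq max_matching_weight_residual_ge (max_matching_weight_residual_le minC).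
Qed.
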